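(* Let $C_4=\mathbb{Z}/4\mathbb{Z}$ with the metric in which distinct adjacent points ($i-j\equiv\pm1 \bmod 4$) have distance $\tfrac12$ and opposite points ($i-j\equiv 2\bmod 4$) have distance $1$. Then $S'(C_4)$ is not a Choquet simplex. More precisely, $S'(C_4)$ is affinely homeomorphic to $P_{C_4}=\operatorname{conv}\{r_0,r_1,r_2,r_3\}\subset\mathbb{R}^4$, where $$r_0=(0,\tfrac12,1,\tfrac12),\quad r_1=(\tfrac12,0,\tfrac12,1),\quad r_2=(1,\tfrac12,0,\tfrac12),\quad r_3=(\tfrac12,1,\tfrac12,0)$$ are the rows of the distance matrix of $C_4$, and $P_{C_4}$ is a non-degenerate parallelogram. Its center $b=(\tfrac12,\tfrac12,\tfrac12,\tfrac12)$ has two distinct representing probability measures carried by $\operatorname{ext}(P_{C_4})$, namely $$\mu_{02}=\tfrac12\delta_{r_0}+\tfrac12\delta_{r_2},\qquad \mu_{13}=\tfrac12\delta_{r_1}+\tfrac12\delta_{r_3},$$ that is, $$b=\int_{P_{C_4}}z\,d\mu_{02}(z)=\int_{P_{C_4}}z\,d\mu_{13}(z),\qquad \mu_{02}\ne\mu_{13}.$$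
   Context: The construction $S'$: Let $(X,d)$ be a nonempty separable metric space with $\operatorname{diam}(X)\le 1$. For a sequence $D=(d_n)_{n\ge 1}$ (repetitions allowed) whose terms form a dense subset of $X$, put $\iota_D:X\to[0,1]^{\mathbb{N}}$, $\iota_D(x)=(d(x,d_1),d(x,d_2),\ldots)$, and let $S'_D(X)$ be the closed convex hull of $\iota_D(X)$ in $[0,1]^{\mathbb{N}}$ (product topology). Up to affine homeomorphism $S'_D(X)$ does not depend on the choice of $D$ (a known result of Sabok), and $S'(X)$ denotes $S'_D(X)$ for any such $D$. A compact metrizable convex set $K$ (in a Hausdorff locally convex space) is a Choquet simplex if each point of $K$ is the barycenter of a unique Borel probability measure carried by the set $\operatorname{ext}(K)$ of extreme points of $K$. $\delta_z$ is the Dirac measure at $z$. An affine homeomorphism is an affine bijection that is a homeomorphism. *)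

(* Defs.v *)
From HB Require Import structures.
From mathcomp Require Import all_boot all_order all_algebra.
From mathcomp Require Import all_classical all_reals all_analysis.
From mathcomp Require Import giry.
Set Implicit Arguments.
Unset Strict Implicit.
Unset Printing Implicit Defensive.
Import Order.TTheory GRing.Theory Num.Theory.
Import numFieldNormedType.Exports.
Local Open Scope classical_set_scope.
Local Open Scope ring_scope.
Local Open Scope convex_scope.

Section convexity.
Context {R : realType}.

Definition convex_hull (E : lmodType R) (A : set E) : set E :=
  smallest (@convex_set R E) A.

Definition closed_convex_hull (E : tvsType R) (A : set E) : set E :=
  smallest [set K | closed K /\ @convex_set R E K] A.

Definition extreme_points (E : lmodType R) (K : set E) : set E :=
  [set x | K x /\ forall (y z : convex_lmodType E) (t : {i01 R}),
     K y -> K z -> 0 < t%:num < 1 -> x = (y <| t |> z) -> y = x /\ z = x].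

Definition affine_on (E F : lmodType R) (K : set E) (f : E -> F) : Prop :=
  forall (x y : convex_lmodType E) (t : {i01 R}), K x -> K y ->
    f (x <| t |> y) = (f x : convex_lmodType F) <| t |> f y.

Definition homeomorphism_between (S T : topologicalType)
    (A : set S) (B : set T) (f : S -> T) (g : T -> S) : Prop :=
  [/\ set_bij A B f, {in A, cancel f g},
      {within A, continuous f} & {within B, continuous g}].

Definition affinely_homeomorphic (E F : tvsType R)
    (K : set E) (L : set F) : Prop :=
  exists (f : E -> F) (g : F -> E),
    homeomorphism_between K L f g /\ affine_on K f.

(* [L] need not be all of [M] only because [f : T -> M] is total. *)
Definition metrizable (T : topologicalType) (K : set T) : Prop :=
  exists (M : metricType R) (L : set M) (f : T -> M) (g : M -> T),
    homeomorphism_between K L f g.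

End convexity.

(* A copy of [E] with its Borel sigma-algebra; [tvsType]s are not pointed, as
   [measurableType]s have to be, hence the base point [0]. *)
Definition borel {R : realType} (E : tvsType R) : Type := E.

Section borel.
Context {R : realType} (E : tvsType R).
Let openE : set (set E) := @open E.

HB.instance Definition _ := Choice.on (borel E).
HB.instance Definition _ := isPointed.Build (borel E) (0 : E).
HB.instance Definition _ := @isMeasurable.Build (sigma_display openE) (borel E)
  <<s openE >> (@sigma_algebra0 _ setT openE) (@sigma_algebraC (borel E) openE)
  (@sigma_algebra_bigcup _ setT openE).

End borel.

Section choquet.
Context {R : realType}.
Implicit Types E : tvsType R.

Definition carried_by E (mu : probability (borel E) R) (A : set E) : Prop :=
  mu.-negligible (~` A).

Definition barycenter E (K : set E) (mu : probability (borel E) R) (x : E) :=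
  forall f : {linear E -> R^o}, continuous f ->
    (\int[mu]_(z in K) (f z)%:E = (f x)%:E)%E.

Definition represents E (K : set E) (mu : probability (borel E) R) (x : E) :=
  carried_by mu (extreme_points K) /\ barycenter K mu x.

Definition compact_metrizable_convex E (K : set E) : Prop :=
  [/\ compact K, @metrizable R E K & @convex_set R E K].

(* Measures are compared on Borel sets only: a [probability] is a function on
   all subsets, with irrelevant values on the non-measurable ones. *)
Definition choquet_simplex E (K : set E) : Prop :=
  compact_metrizable_convex K /\
  forall x, K x -> exists2 mu : probability (borel E) R,
    represents K mu x & forall nu, represents K nu x -> nu ≡μ mu.

Definition half_dirac2 E (a b : E) : set (borel E) -> \bar R :=
  measure_add (mscale (2^-1)%:nng (dirac (a : borel E)))
              (mscale (2^-1)%:nng (dirac (b : borel E))).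

HB.instance Definition _ E (a b : E) := Measure.on (half_dirac2 a b).

Let half_dirac2_setT E (a b : E) : half_dirac2 a b setT = 1%E.
Proof.
rewrite /half_dirac2 measure_addE /= /mscale /= !diracT !mule1 -EFinD.
by congr EFin; rewrite [RHS]splitr mul1r.
Qed.

HB.instance Definition _ E (a b : E) :=
  Measure_isProbability.Build _ _ _ (half_dirac2 a b) (half_dirac2_setT a b).

End choquet.

Definition RN (R : realType) : Type := {ptws nat -> R^o}.

Section RN_tvs.
Variable R : realType.

HB.instance Definition _ := Uniform.copy (RN R) {ptws nat -> R^o}.
HB.instance Definition _ := GRing.Lmodule.copy (RN R) (nat -> R^o).

Lemma RN_cvgP (F : set_system (RN R)) (f : RN R) : Filter F ->
  F --> f <-> forall i, (fun g : RN R => g i) @ F --> f i.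
Proof. exact: (@pointwise_cvgP nat R^o F). Qed.

Lemma RN_proj_continuous i : continuous (fun g : RN R => g i).
Proof. by move=> f; exact: (RN_cvgP f (nbhs_filter f)).1. Qed.

Let RN_continuous (T : topologicalType) (h : T -> RN R) (p : T) :
  (forall i, (fun x => h x i : R^o) @ p --> (h p i : R^o)) -> h @ p --> h p.
Proof.
have FF : Filter (h @ p) by exact: (@fmap_filter T (RN R) h (nbhs p)).
by move=> hi; apply/(RN_cvgP (h p) FF).
Qed.

Let RN_add_continuous : continuous (fun x : RN R * RN R => x.1 + x.2).
Proof.
move=> p; apply: (@RN_continuous _ (fun x : RN R * RN R => x.1 + x.2) p) => i.
have c1 : (fun z : RN R * RN R => z.1 i : R^o) @ p --> (p.1 i : R^o).
  apply: (@cvg_comp _ _ _ fst (fun g : RN R => g i)); first exact: cvg_fst.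
  exact: RN_proj_continuous.
have c2 : (fun z : RN R * RN R => z.2 i : R^o) @ p --> (p.2 i : R^o).
  apply: (@cvg_comp _ _ _ snd (fun g : RN R => g i)); first exact: cvg_snd.
  exact: RN_proj_continuous.
exact: (cvgD c1 c2).
Qed.

Let RN_scale_continuous : continuous (fun z : R^o * RN R => z.1 *: z.2).
Proof.
move=> p; apply: (@RN_continuous _ (fun z : R^o * RN R => z.1 *: z.2) p) => i.
have c1 : (fun z : R^o * RN R => z.1) @ p --> p.1 by exact: cvg_fst.
have c2 : (fun z : R^o * RN R => z.2 i : R^o) @ p --> (p.2 i : R^o).
  apply: (@cvg_comp _ _ _ snd (fun g : RN R => g i)); first exact: cvg_snd.
  exact: RN_proj_continuous.
exact: (cvgZ c1 c2).
Qed.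

Let RN_locally_convex : exists2 B : set_system (RN R),
  (forall b, b \in B -> convex_set b) & basis B.
Proof.
exists [set U : set (RN R) | open U /\ @convex_set R (RN R) U].
  by move=> b; rewrite inE => -[].
split=> [b []//|x].
pose F := filter_from [set U : set (RN R) |
  (open U /\ @convex_set R (RN R) U) /\ U x] id.
have FF : Filter F.
  apply: filter_from_filter.
    exists setT => //; split=> //; split; first exact: openT.
    by move=> y z t _ _; exact: mem_set.
  move=> U V [[oU cU] Ux] [[oV cV] Vx]; exists (U `&` V) => //.
  split=> //; split; first exact: openI.
  move=> y z t; rewrite !in_setI => /andP[Uy Vy] /andP[Uz Vz].
  by rewrite (cU _ _ _ Uy Uz) (cV _ _ _ Vy Vz).
apply/(RN_cvgP x FF) => i V /=.
rewrite -nbhs_ballE => -[e /= e0 xeV].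
exists ((fun g : RN R => g i) @^-1` ball (x i) e); last by move=> y /xeV.
split; last exact: ballxx.
split.
  apply: open_comp; first by move=> *; exact: RN_proj_continuous.
  exact: ball_open.
move=> y z t /=; rewrite !inE -!ball_normE /= => yb zb.
have -> : x i - (y <| t |> z : RN R) i =
    t%:num * (x i - y i) + (1 - t%:num) * (x i - z i).
  by rewrite !mulrBr addrACA -mulrDl subrKC mul1r -opprD.
have t0 : 0 <= t%:num :> R by [].
have t1 : 0 <= 1 - t%:num :> R by rewrite subr_ge0.
rewrite (le_lt_trans (ler_normD _ _))// !normrM (ger0_norm t0) (ger0_norm t1).
have -> : e = t%:num * e + (1 - t%:num) * e.
  by rewrite -mulrDl subrKC mul1r.
have [->|tn0] := eqVneq (t%:num : R) 0.
  by rewrite !mul0r !add0r subr0 !mul1r.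
apply: ltr_leD; last by rewrite ler_wpM2l// ltW.
by rewrite ltr_pM2l// lt_neqAle eq_sym tn0.
Qed.

HB.instance Definition _ :=
  PreTopologicalNmodule_isTopologicalNmodule.Build (RN R) RN_add_continuous.
HB.instance Definition _ := TopologicalNmodule_isTopologicalLmodule.Build
  R (RN R) RN_scale_continuous.
HB.instance Definition _ := Uniform_isTvs.Build R (RN R) RN_locally_convex.

End RN_tvs.

(* Sequences are indexed from 0 instead of 1. The closed convex hull is taken
   in R^N: when diam X <= 1 it is also the one in [0,1]^N, a closed convex set
   which then contains the range of [iota_D D]. *)
Section S_prime.
Context {R : realType} {X : metricType R}.

Definition iota_D (D : nat -> X) (x : X) : RN R := fun n => mdist x (D n).

Definition S_prime (D : nat -> X) : set (RN R) :=
  closed_convex_hull (range (iota_D D)).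

End S_prime.

(* [R] is a parameter since the metric takes its values there. *)
Definition C4 (R : realType) : Type := 'Z_4.

Section C4_metric.
Variable R : realType.

Definition C4_dist (i j : 'Z_4) : R :=
  if i == j then 0 else if i - j \in [:: 1; -1] then 2^-1 else 1.

Let dist_sym i j : C4_dist i j = C4_dist j i.
Proof.
rewrite /C4_dist eq_sym; case: eqP => // _.
by rewrite -(opprB j i) !inE !eqr_oppLR opprK orbC.
Qed.

Let distxx i : C4_dist i i = 0.
Proof. by rewrite /C4_dist eqxx. Qed.

Let dist_le1 i j : C4_dist i j <= 1.
Proof. by rewrite /C4_dist; do 2?[case: ifP => _]; rewrite ?invf_le1 ?ler1n. Qed.

Let dist_ge i j : i != j -> 2^-1 <= C4_dist i j.
Proof.
rewrite /C4_dist => /negPf ->.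
by case: ifP => _; rewrite ?invf_le1 ?ler1n.
Qed.

Let dist_eq0 i j : C4_dist i j = 0 -> i = j.
Proof.
move=> ij; apply/eqP; apply: contraT => /dist_ge.
by rewrite ij leNgt invr_gt0 ltr0n.
Qed.

Let dist_triangle j i k : C4_dist i k <= C4_dist i j + C4_dist j k.
Proof.
have [->|ij] := eqVneq i j; first by rewrite distxx add0r.
have [->|jk] := eqVneq j k; first by rewrite distxx addr0.
apply: (le_trans (dist_le1 i k)).
by rewrite [leLHS]splitr mul1r lerD// dist_ge.
Qed.

HB.instance Definition _ := Choice.on (C4 R).
HB.instance Definition _ :=
  @isMetric.Build R (C4 R) C4_dist distxx dist_eq0 dist_sym dist_triangle.

Definition C4_dist_matrix : 'M[R]_4 := \matrix_(i, j) mdist (i : C4 R) j.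

End C4_metric.

Section parallelogram.
Variable R : realType.

Definition row4 (a b c d : R) : 'rV[R]_4 := \row_j [:: a; b; c; d]`_j.

Definition r0 := row4 0 2^-1 1 2^-1.
Definition r1 := row4 2^-1 0 2^-1 1.
Definition r2 := row4 1 2^-1 0 2^-1.
Definition r3 := row4 2^-1 1 2^-1 0.

Definition P_C4 : set 'rV[R]_4 := convex_hull [set r0; r1; r2; r3].

Definition nondegenerate_parallelogram (P : set 'rV[R]_4) (center : 'rV[R]_4) :=
  exists p u v : 'rV[R]_4, [/\ free [:: u; v],
    P = [set p + s *: u + t *: v | s in `[0, 1] & t in `[0, 1]]
    & center = p + 2^-1 *: (u + v)].

Definition b_C4 := row4 2^-1 2^-1 2^-1 2^-1.

Definition mu02 : probability (borel 'rV[R]_4) R := half_dirac2 r0 r2.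
Definition mu13 : probability (borel 'rV[R]_4) R := half_dirac2 r1 r3.

Definition row_integral (mu : probability (borel 'rV[R]_4) R)
    (A : set 'rV[R]_4) : 'rV[R]_4 :=
  \row_j \int[mu]_(z in A) (z : 'rV[R]_4) 0 j.

End parallelogram.

Arguments P_C4 : clear implicits.

(* Main.v *)
(* The rows r_i satisfy r_0 + r_2 = r_1 + r_3, so P_{C_4} is the parallelogram
   spanned at r_0 by r_1 - r_0 and r_3 - r_0; since the i-th coordinate is
   nonnegative on it and vanishes only at r_i, the r_i are exposed, hence
   extreme, and both pairs of opposite vertices represent the center. A dense
   sequence D in the discrete space C_4 takes every value, so the linear map
   y |-> (y_{D_n})_n is an embedding of R^4 into R^N; it sends r_i to iota_D(i),
   hence P_{C_4} onto S'_D(C_4), and any choice of indices n_i with D_{n_i} = i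
   gives a continuous linear left inverse. *)

Require Import Defs.
From HB Require Import structures.
From mathcomp Require Import all_boot all_order all_algebra.
From mathcomp Require Import all_classical all_reals all_analysis.
From mathcomp Require Import giry measurable_realfun.
From mathcomp Require Import ring lra.
Set Implicit Arguments.
Unset Strict Implicit.
Unset Printing Implicit Defensive.
Import Order.TTheory GRing.Theory Num.Theory.
Import numFieldNormedType.Exports.
Local Open Scope classical_set_scope.
Local Open Scope ring_scope.

(** * Convex sets, exposed points and parallelograms *)

Section convexity.
Context {R : realType}.

Lemma convex_setP (E : lmodType R) (A : set E) :
  convex_set A <-> forall x y (t : R), A x -> A y -> 0 <= t <= 1 ->
    A (t *: x + (1 - t) *: y).
Proof.
split=> [cA x y t Ax Ay /andP[t0 t1]|cA x y t].
  by have := cA x y (Itv01 t0 t1) (mem_set Ax) (mem_set Ay); rewrite inE.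
rewrite !inE => Ax Ay; apply: cA => //.
by apply/andP; split; [exact: ge0|exact: le1].
Qed.

Lemma convex_set_image (E F : lmodType R) (g : {linear E -> F}) (A : set E) :
  convex_set A -> convex_set (g @` A).
Proof.
move=> /convex_setP cA; apply/convex_setP => _ _ t [x Ax <-] [y Ay <-] t01.
by exists (t *: x + (1 - t) *: y); [exact: cA|rewrite linearD !linearZ].
Qed.

Lemma convex_set_preimage (E F : lmodType R) (g : {linear E -> F})
  (A : set F) : convex_set A -> convex_set (g @^-1` A).
Proof.
move=> /convex_setP cA; apply/convex_setP => x y t Ax Ay t01.
by rewrite /preimage/= linearD !linearZ; exact: cA.
Qed.

Lemma linear_affine_on (E F : lmodType R) (K : set E) (f : {linear E -> F}) :
  affine_on K f.
Proof. by move=> x y t _ _; rewrite /conv/= linearD !linearZ. Qed.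

(** If [a] is a proper convex combination of [y] and [z], then [h a] is the same combination of
    [h y] and [h z], neither of which is below [h a]. Both therefore equal the minimum, which is
    attained only at [a]. *)
Lemma exposed_extreme (E : lmodType R) (K : set E) (h : E -> R^o) a :
  affine_on K h -> K a -> (forall x, K x -> h a <= h x) ->
  (forall x, K x -> h x = h a -> x = a) -> extreme_points K a.
Proof.
move=> affh Ka ha hK; split=> // y z t Ky Kz /andP[t0 t1] ayz.
have : h a = t%:num * h y + (1 - t%:num) * h z by rewrite ayz; exact: affh.
have := ha _ Ky; have := ha _ Kz => hz hy e.
by split; apply: hK => //; apply/eqP; rewrite eq_le ?hy ?hz ?andbT; nra.
Qed.

Definition parallelogram (E : lmodType R) (p u v : E) : set E :=
  [set p + s *: u + t *: v | s in `[0, 1] & t in `[0, 1]].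

Lemma convex_hull_parallelogram (E : lmodType R) (p u v : E) :
  convex_hull [set p; p + u; p + u + v; p + v] = parallelogram p u v.
Proof.
have i0 : (0 : R) \in `[0, 1] by rewrite in_itv/= lexx ler01.
have i1 : (1 : R) \in `[0, 1] by rewrite in_itv/= lexx ler01.
apply/seteqP; split.
  apply: smallest_sub.
    apply/convex_setP => _ _ k [s + [t + <-]] [s' + [t' + <-]] /andP[k0 k1].
    rewrite /= !in_itv/= => /andP[s0 s1] /andP[t0 t1].
    move=> /andP[s'0 s'1] /andP[t'0 t'1].
    exists (k * s + (1 - k) * s').
      by rewrite /= in_itv/=; apply/andP; split; nra.
    exists (k * t + (1 - k) * t').
      by rewrite /= in_itv/=; apply/andP; split; nra.
    rewrite !scalerDr !scalerA (addrACA _ (_ *: v)).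
    by rewrite (addrACA _ (_ *: u)) -!scalerDl subrKC scale1r.
  move=> _ [[[]|]|] ->.
  - by exists 0 => //; exists 0 => //; rewrite !scale0r !addr0.
  - by exists 1 => //; exists 0 => //; rewrite scale0r addr0 scale1r.
  - by exists 1 => //; exists 1 => //; rewrite !scale1r.
  - by exists 0 => //; exists 1 => //; rewrite scale0r addr0 scale1r.
move=> _ [s + [t + <-]] A [/convex_setP cA vA].
rewrite /= !in_itv/= => /andP[s0 s1] t01.
(* [Au] fills a segment in direction [u]. Applied to the two sides from [p] and from [p + v], it
   leaves a single segment in direction [v] through the given point. *)
have Au b : A b -> A (b + u) -> A (b + s *: u).
  move=> Ab Abu; have := cA _ _ s Abu Ab; rewrite s0 s1 => /(_ isT).
  by rewrite scalerDr addrAC -scalerDl subrKC scale1r.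
have Ap : A (p + s *: u) by apply: Au; apply: vA; rewrite /=; tauto.
have Apv : A (p + v + s *: u).
  by apply: Au; apply: vA; rewrite /= 1?[p + v + u]addrAC; tauto.
have := cA _ _ t Apv Ap t01.
by rewrite [p + v + _]addrAC scalerDr addrAC -scalerDl subrKC scale1r.
Qed.

(** A continuous image of the compact unit square. *)
Lemma compact_parallelogram (V : normedModType R) (p u v : V) :
  compact (parallelogram p u v).
Proof.
have -> : parallelogram p u v =
    (fun z : R^o * R^o => p + z.1 *: u + z.2 *: v) @` (`[0, 1] `*` `[0, 1]).
  apply/seteqP; split=> [_ [s s01 [t t01 <-]]|_ [[s t] [s01 t01] <-]].
    by exists (s, t).
  by exists s => //; exists t.
apply: continuous_compact; last by apply: compact_setX; exact: segment_compact.
apply: continuous_subspaceT => z.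
apply: cvgD; last by apply: cvgZr_tmp; exact: cvg_snd.
by apply: cvgD; [exact: cvg_cst|apply: cvgZr_tmp; exact: cvg_fst].
Qed.

End convexity.

(* Normed modules are only pseudometric spaces in the library: this copy is a
   [metricType]. *)
Definition normed_metric (R : realType) (V : normedModType R) : Type := V.

Section normed_metric.
Context {R : realType} (V : normedModType R).

HB.instance Definition _ := PseudoMetric.on (normed_metric V).

Let dist (x y : normed_metric V) : R := `|(x : V) - y|.

Let dist_ge0 x y : 0 <= dist x y.
Proof. exact: normr_ge0. Qed.

Let dist_positivity x y : dist x y = 0 -> x = y.
Proof. by move/normr0_eq0/eqP; rewrite subr_eq0 => /eqP. Qed.

Let ballEdist (x : normed_metric V) e : ball x e = [set y | dist x y < e].
Proof. by have := @ball_normE R V; move=> /(congr1 (fun B => B x e)) <-. Qed.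

HB.instance Definition _ := @PseudoMetric_isMetric.Build R (normed_metric V)
  dist dist_ge0 dist_positivity ballEdist.

End normed_metric.

(** * Borel measurability and half-sums of two Dirac measures *)

Section borel.
Context {R : realType} {E : tvsType R}.
Implicit Types K : set E.

Lemma open_borel (A : set E) : open A -> measurable (A : set (borel E)).
Proof. by move=> oA; exact: sub_sigma_algebra. Qed.

Lemma closed_borel (A : set E) : closed A -> measurable (A : set (borel E)).
Proof.
by move=> /closed_openC/open_borel/measurableC; rewrite setCK.
Qed.

Lemma continuous_borel_measurable (h : E -> R) : continuous h ->
  measurable_fun setT (h : borel E -> R).
Proof.
move=> /continuousP ch; apply: (measurability _ (RGenOpens.measurableE R)).
move=> _ [_ [a [b ->] <-]]; rewrite setTI; apply: open_borel.
by apply: ch; exact: interval_open.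
Qed.

(** For nonnegative integrands ([ge0E]) the integral is additive and homogeneous in the measure. The
    signed case follows by splitting [h] into positive and negative parts; closedness of [K] makes
    it Borel. *)
Lemma integral_half_dirac2 K (a b : E) (h : E -> R) :
  continuous h -> closed K -> K a -> K b ->
  (\int[half_dirac2 a b]_(z in K) (h z)%:E = (2^-1 * h a + 2^-1 * h b)%:E)%E.
Proof.
move=> ch cK Ka Kb; have mK := closed_borel cK.
have mh : measurable_fun (K : set (borel E)) (EFin \o h).
  apply/measurable_EFinP; apply: measurable_funTS.
  exact: continuous_borel_measurable.
have ge0E (f : borel E -> \bar R) : measurable_fun (K : set (borel E)) f ->
    (forall z, 0 <= f z)%E ->
    (\int[half_dirac2 a b]_(z in K) f z = 2^-1%:E * f a + 2^-1%:E * f b)%E.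
  move=> mf f0; rewrite /half_dirac2 ge0_integral_measure_add//.
  rewrite !ge0_integral_mscale//= !integral_dirac//.
  by rewrite !diracE !mem_set// !mul1e.
rewrite integralE !ge0E//; last 2 first.
  exact: measurable_funeneg.
  exact: measurable_funepos.
rewrite !funeposE !funenegE /= -[0%E]/(0%:E) -!EFin_max -!EFinM.
rewrite -!EFinD; congr EFin.
(* The positive part is [x] plus the negative part, so the negative parts cancel. *)
have maxB (x : R) : Num.max x 0 = x + Num.max (- x) 0.
  by case: (leP x 0) => ?; case: (leP (- x) 0) => ?; lra.
by rewrite (maxB (h a)) (maxB (h b)); ring.
Qed.

Lemma half_dirac2_notin (a b : E) (A : set E) : ~ A a -> ~ A b ->
  half_dirac2 a b A = 0%E.
Proof.
move=> nAa nAb; rewrite /half_dirac2 measure_addE /= /mscale /= !diracE.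
by rewrite !memNset// !mule0 adde0.
Qed.

Lemma half_dirac2_fst_neq0 (a b : E) (A : set E) : A a ->
  half_dirac2 a b A != 0%E.
Proof.
move=> Aa; rewrite /half_dirac2 measure_addE /= /mscale /= !diracE mem_set//.
by rewrite -EFinM -EFinD eqe/= gt_eqF// ltr_pwDl ?mulr_ge0// mulr1.
Qed.

Lemma represents_half_dirac2 K (a b : E) : hausdorff_space E -> closed K ->
  extreme_points K a -> extreme_points K b ->
  represents K (half_dirac2 a b) (2^-1 *: (a + b)).
Proof.
move=> hE cK ea eb; split.
  (* A Borel null set that covers the complement of the extreme points. With this witness, the set
     of extreme points need not be shown to be Borel. *)
  exists (~` [set a; b]); split.
  - apply: open_borel; apply: closed_openC.
    have cl1 : forall x : E, closed [set x].
      by apply/accessible_closed_set1/hausdorff_accessible.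
    exact: closedU.
  - by apply: half_dirac2_notin => -[] /=; tauto.
  - by apply: subsetC => _ [->|->].
move=> f cf; rewrite integral_half_dirac2//; [|exact: ea.1|exact: eb.1].
by rewrite linearZ linearD /= -mulrDr.
Qed.

(** The singleton of [a] tells the measures apart: it has positive mass under the first and mass 0
    under the second. It is Borel because points are closed in a Hausdorff space. *)
Lemma half_dirac2_neq (a b c d : E) : hausdorff_space E ->
  a <> c -> a <> d -> ~ (half_dirac2 a b ≡μ half_dirac2 c d).
Proof.
move=> hE ac ad e.
have ma : measurable ([set a] : set (borel E)).
  by apply: closed_borel; exact/accessible_closed_set1/hausdorff_accessible.
have := half_dirac2_fst_neq0 b (erefl a : [set a] a).
suff -> : half_dirac2 a b [set a] = 0%E by rewrite eqxx.
by rewrite (e _ ma); apply: half_dirac2_notin => /esym.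
Qed.

End borel.

(** * The parallelogram in R^4: facets, vertices and center *)

Section C4.
Context {R : realType}.
Local Notation r0 := (r0 R).
Local Notation r1 := (r1 R).
Local Notation r2 := (r2 R).
Local Notation r3 := (r3 R).
Local Notation P_C4 := (P_C4 R).
Local Notation M := (C4_dist_matrix R).

Lemma row_C4_dist_matrix i : row i M = [:: r0; r1; r2; r3]`_i.
Proof.
by apply/rowP => j; case: i j => [[|[|[|[|//]]]] ?] [[|[|[|[|//]]]] ?];
  rewrite !mxE.
Qed.

Lemma P_C4_parallelogram : P_C4 = parallelogram r0 (r1 - r0) (r3 - r0).
Proof.
rewrite -convex_hull_parallelogram; congr convex_hull.
have -> : r0 + (r1 - r0) + (r3 - r0) = r2.
  apply/rowP => -[[|[|[|[|//]]]] ?]; rewrite !mxE /=; lra.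
by rewrite !subrKC.
Qed.

Lemma row_C4_P_C4 i : P_C4 (row i M).
Proof.
rewrite row_C4_dist_matrix; apply: sub_gen_smallest => /=.
by case: i => [[|[|[|[|//]]]] ?] /=; tauto.
Qed.

(** In the parameters [s], [t] the four coordinates are [(s + t) / 2], [(1 - s + t) / 2],
    [(2 - s - t) / 2] and [(1 + s - t) / 2]. *)
Lemma P_C4_coord_ge0 y i : P_C4 y -> 0 <= y 0 i.
Proof.
rewrite P_C4_parallelogram => -[s + [t + <-]].
rewrite /= !in_itv/= => /andP[s0 s1] /andP[t0 t1].
by case: i => [[|[|[|[|//]]]] ?]; rewrite !mxE /=; lra.
Qed.

(** On the unit square these four expressions vanish only at the corners (0,0), (1,0), (1,1) and
    (0,1) respectively, the parameters of the four rows. *)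
Lemma P_C4_coord_eq0 y i : P_C4 y -> y 0 i = 0 -> y = row i M.
Proof.
rewrite P_C4_parallelogram => -[s + [t + <-]].
rewrite /= !in_itv/= => /andP[s0 s1] /andP[t0 t1] yi0.
rewrite row_C4_dist_matrix.
case: i yi0 => [[|[|[|[|//]]]] ?]; rewrite !mxE /= => yi0.
- have -> : s = 0 by lra. have -> : t = 0 by lra.
  by rewrite !scale0r !addr0.
- have -> : s = 1 by lra. have -> : t = 0 by lra.
  by rewrite scale0r scale1r addr0 subrKC.
- have -> : s = 1 by lra. have -> : t = 1 by lra.
  by rewrite !scale1r; apply/rowP => -[[|[|[|[|//]]]] ?]; rewrite !mxE /=; lra.
- have -> : s = 0 by lra. have -> : t = 1 by lra.
  by rewrite scale0r scale1r addr0 subrKC.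
Qed.

Lemma compact_P_C4 : compact P_C4.
Proof. by rewrite P_C4_parallelogram; exact: compact_parallelogram. Qed.

Lemma closed_P_C4 : closed P_C4.
Proof. exact: compact_closed (@norm_hausdorff _ _) compact_P_C4. Qed.

Lemma convex_P_C4 : convex_set P_C4.
Proof.
apply/convex_setP => x y t Px Py t01 A [cA vA].
by move/convex_setP: (cA); apply=> //; [exact: Px|exact: Py].
Qed.

Lemma b_C4E : b_C4 R = 2^-1 *: (r0 + r2) /\ b_C4 R = 2^-1 *: (r1 + r3).
Proof.
by split; apply/rowP => -[[|[|[|[|//]]]] ?]; rewrite !mxE /=; lra.
Qed.

Lemma P_C4_nondegenerate : nondegenerate_parallelogram P_C4 (b_C4 R).
Proof.
exists r0, (r1 - r0), (r3 - r0); split; last 2 first.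
- exact: P_C4_parallelogram.
- rewrite b_C4E.2; apply/rowP => -[[|[|[|[|//]]]] ?]; rewrite !mxE /=; lra.
apply/freeP => k; rewrite big_ord_recl big_ord1 => k0.
(* Coordinates 0 and 1 of the relation read [(k 0 + k 1) / 2 = 0] and [(k 1 - k 0) / 2 = 0], which
   forces both coefficients to vanish. *)
have := congr1 (fun y : 'rV_4 => y 0 1) k0.
have := congr1 (fun y : 'rV_4 => y 0 0) k0.
rewrite !mxE /= => k1 k2.
have k00 : k 0 = 0 by lra.
have k10 : k (lift ord0 ord0) = 0 by lra.
case=> [[|[|//]] ?]; [rewrite -k00|rewrite -k10]; by congr k; exact: val_inj.
Qed.

Lemma P_C4_b_C4 : P_C4 (b_C4 R).
Proof.
rewrite P_C4_parallelogram; exists 2^-1; first by rewrite /= in_itv/=; lra.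
exists 2^-1; first by rewrite /= in_itv/=; lra.
by apply/rowP => -[[|[|[|[|//]]]] ?]; rewrite !mxE /=; lra.
Qed.

Lemma r0_neq_r1 : r0 <> r1.
Proof.
by move=> /(congr1 (fun y : 'rV_4 => y 0 0)); rewrite !mxE /=; lra.
Qed.

Lemma r0_neq_r3 : r0 <> r3.
Proof.
by move=> /(congr1 (fun y : 'rV_4 => y 0 0)); rewrite !mxE /=; lra.
Qed.

(** The map [h] recovers coordinate [i], which is minimal on the parallelogram exactly at row [i],
    where it is the distance from [i] to itself. Stated for an image under [g] so as to serve both
    in R^4 ([g] the identity) and in R^N. *)
Lemma extreme_image_P_C4 (E : lmodType R) (g : 'rV[R]_4 -> E) (h : E -> R^o) i :
  affine_on (g @` P_C4) h -> (forall y, h (g y) = y 0 i) ->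
  extreme_points (g @` P_C4) (g (row i M)).
Proof.
have Mii : row i M 0 i = 0 by rewrite !mxE mdistxx.
move=> affh hg; apply: (exposed_extreme affh); rewrite ?hg ?Mii.
- by exists (row i M) => //; exact: row_C4_P_C4.
- by move=> _ [y Py <-]; rewrite hg; exact: P_C4_coord_ge0.
- by move=> _ [y Py <-]; rewrite hg => /(P_C4_coord_eq0 Py) ->.
Qed.

Lemma extreme_P_C4 i : extreme_points P_C4 (row i M).
Proof.
have := @extreme_image_P_C4 _ id (fun y => y 0 i) i; rewrite image_id.
apply=> //.
by move=> x y t _ _; rewrite !mxE.
Qed.

Lemma row_integral_half_dirac2 (a b : 'rV[R]_4) (A : set 'rV[R]_4) :
  closed A -> A a -> A b -> row_integral (half_dirac2 a b) A = 2^-1 *: (a + b).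
Proof.
move=> cA Aa Ab; apply/rowP => j; rewrite !mxE /Rintegral.
rewrite (integral_half_dirac2 (h := fun y : 'rV[R]_4 => y 0 j))//=.
  by rewrite mulrDr.
exact: coord_continuous.
Qed.

End C4.

(** * Continuity by coordinates, and embeddings with a continuous left inverse *)

Lemma continuous_mx {R : realType} (T : topologicalType) m n
    (f : T -> 'M[R]_(m, n)) :
  (forall i j, continuous (fun x => f x i j)) -> continuous f.
Proof.
move=> cf x A [P nP PA]; apply: filterS (PA) _.
by do 2 apply: filter_forall => ?; exact: cf.
Qed.

Lemma continuous_RN {R : realType} (T : topologicalType) (f : T -> RN R) :
  (forall n, continuous (fun x => f x n : R^o)) -> continuous f.
Proof. by move=> cf x; apply/RN_cvgP => n; exact: cf. Qed.

Lemma RN_hausdorff (R : realType) : hausdorff_space (RN R).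
Proof.
by apply: (@hausdorff_product nat (fun=> R^o)) => _; exact: norm_hausdorff.
Qed.

Lemma retract_homeomorphism (S T : topologicalType) (A : set T)
    (f : S -> T) (g : T -> S) :
  cancel g f -> continuous f -> continuous g ->
  homeomorphism_between (g @` A) A f g.
Proof.
move=> gK cf cg; split; [split| | |].
- by move=> _ [y Ay <-]; rewrite gK.
- by move=> x y /set_mem[x' _ <-] /set_mem[y' _ <-]; rewrite !gK => ->.
- by move=> y Ay; exists (g y); [exists y|rewrite gK].
- by move=> x /set_mem[y _ <-]; rewrite gK.
- exact: continuous_subspaceT.
- exact: continuous_subspaceT.
Qed.

(** * The set S' of C_4 as a linear image of the parallelogram *)

Section S_prime_C4.
Context {R : realType} (D : nat -> C4 R).
Local Notation M := (C4_dist_matrix R).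

Lemma dense_C4_surjective : dense (range D) ->
  forall i : C4 R, exists n, D n = i.
Proof.
move=> dD i; have half_gt0 : 0 < 2^-1 :> R by rewrite invr_gt0.
(* Distinct points are at least 1/2 apart, so the open ball of radius 1/2 around [i] is [i] alone,
   and density puts a term of [D] in it. *)
have [] := dD (ball i 2^-1)°; first by exists i; exact: nbhsx_ballx.
  exact: open_interior.
move=> j [/interior_subset ij [n _ nE]]; exists n.
move: ij; rewrite ballEmdist/= -nE /mdist/= /C4_dist.
case: eqP => [->//|_]; case: ifP => _; first by rewrite ltxx.
by rewrite ltNge invf_le1 ?ler1n.
Qed.

Definition C4_embed (y : 'rV[R]_4) : RN R := fun n => y 0 (D n).

Let C4_embed_linear : linear C4_embed.
Proof. by move=> k x y; apply/funext => n; rewrite /C4_embed !mxE. Qed.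

HB.instance Definition _ :=
  GRing.isLinear.Build R 'rV[R]_4 (RN R) *:%R C4_embed C4_embed_linear.

Lemma C4_embed_continuous : continuous C4_embed.
Proof. by apply: continuous_RN => n; exact: coord_continuous. Qed.

Lemma C4_embed_row i : C4_embed (row i M) = iota_D D i.
Proof. by apply/funext => n; rewrite /C4_embed !mxE. Qed.

Lemma compact_C4_embed : compact (C4_embed @` P_C4 R).
Proof.
apply: continuous_compact; last exact: compact_P_C4.
by apply: continuous_subspaceT; exact: C4_embed_continuous.
Qed.

Lemma closed_C4_embed : closed (C4_embed @` P_C4 R).
Proof. exact: compact_closed (@RN_hausdorff R) compact_C4_embed. Qed.

(** The image is convex, closed because compact, and contains every [iota_D D i]. Conversely, if a
    closed convex [K] contains these points, its preimage under [C4_embed] is convex and contains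
    the four rows, hence contains their convex hull. *)
Lemma S_prime_C4E : S_prime D = C4_embed @` P_C4 R.
Proof.
apply/seteqP; split.
  apply: smallest_sub.
    split; first exact: closed_C4_embed.
    by apply: convex_set_image; exact: convex_P_C4.
  move=> _ [i _ <-]; exists (row i M); first exact: row_C4_P_C4.
  exact: C4_embed_row.
move=> _ [y Py <-] K [[_ cK] iK]; apply: (Py (C4_embed @^-1` K)); split.
  exact: convex_set_preimage.
have Ki i : K (C4_embed (row i M)) by rewrite C4_embed_row; apply: iK; exists i.
by move=> _ [[[]|]|] ->; [move: (Ki 0)|move: (Ki 1)|move: (Ki 2)|move: (Ki 3)];
  rewrite row_C4_dist_matrix.
Qed.

Hypothesis D_surj : forall i : C4 R, exists n, D n = i.

Let idx (i : 'I_4) : nat := projT1 (cid (D_surj i)).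

Let D_idx i : D (idx i) = i.
Proof. by rewrite /idx; case: cid. Qed.

Definition C4_restrict (x : RN R) : 'rV[R]_4 := \row_i x (idx i).

Let C4_restrict_linear : linear C4_restrict.
Proof. by move=> k x y; apply/rowP => i; rewrite !mxE. Qed.

HB.instance Definition _ := GRing.isLinear.Build R (RN R) 'rV[R]_4 *:%R
  C4_restrict C4_restrict_linear.

Lemma C4_restrict_continuous : continuous C4_restrict.
Proof.
apply: continuous_mx => i j; under eq_fun do rewrite mxE.
exact: RN_proj_continuous.
Qed.

Lemma C4_embedK : cancel C4_embed C4_restrict.
Proof. by move=> y; apply/rowP => i; rewrite mxE /C4_embed D_idx. Qed.

Lemma C4_embed_homeomorphism :
  homeomorphism_between (C4_embed @` P_C4 R) (P_C4 R) C4_restrict C4_embed.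
Proof.
apply: retract_homeomorphism; first exact: C4_embedK.
  exact: C4_restrict_continuous.
exact: C4_embed_continuous.
Qed.

Lemma S_prime_C4_compact_metrizable_convex :
  compact_metrizable_convex (S_prime D).
Proof.
rewrite S_prime_C4E; split; first exact: compact_C4_embed.
  (* The metric is transported from the norm of R^4. *)
  exists (normed_metric 'rV[R]_4), (P_C4 R), C4_restrict, C4_embed.
  exact: C4_embed_homeomorphism.
by apply: convex_set_image; exact: convex_P_C4.
Qed.

Lemma S_prime_C4_not_choquet : ~ choquet_simplex (S_prime D).
Proof.
rewrite S_prime_C4E => -[_].
have Mi i : extreme_points (C4_embed @` P_C4 R) (C4_embed (row i M)).
  (* Coordinate [idx i] of R^N exposes the image of row [i], because [D] takes the value [i] at that
     index. *)
  apply: (@extreme_image_P_C4 _ _ _ (fun x => x (idx i))).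
    by move=> x y t _ _.
  by move=> y; rewrite /C4_embed D_idx.
have := (Mi 0, Mi 1, Mi 2, Mi 3); rewrite !row_C4_dist_matrix /=.
move=> -[[[e0 e1] e2] e3].
have [b02 b13] := @b_C4E R.
(* Uniqueness at the image of the center would identify both half-sums over opposite vertices with
   the same [mu], although they differ. *)
move=> /(_ _ (ex_intro2 _ _ _ P_C4_b_C4 erefl))[mu _ uniq].
apply: (half_dirac2_neq (a := C4_embed (r0 R)) (b := C4_embed (r2 R))
  (c := C4_embed (r1 R)) (d := C4_embed (r3 R))
  (@RN_hausdorff R)) => [/(can_inj C4_embedK)/r0_neq_r1//|
    /(can_inj C4_embedK)/r0_neq_r3//|A mA].
rewrite (uniq (half_dirac2 (C4_embed (r0 R)) (C4_embed (r2 R))))//; last first.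
  rewrite b02 linearZ linearD.
  apply: represents_half_dirac2 => //; first exact: RN_hausdorff.
  exact: closed_C4_embed.
rewrite (uniq (half_dirac2 (C4_embed (r1 R)) (C4_embed (r3 R))))//.
rewrite b13 linearZ linearD.
apply: represents_half_dirac2 => //; first exact: RN_hausdorff.
exact: closed_C4_embed.
Qed.

Lemma S_prime_C4_affinely_homeomorphic :
  affinely_homeomorphic (S_prime D) (P_C4 R).
Proof.
rewrite S_prime_C4E; exists C4_restrict, C4_embed; split.
  exact: C4_embed_homeomorphism.
exact: linear_affine_on.
Qed.

End S_prime_C4.

Theorem theorem3p1 (R : realType) :
  (forall D : nat -> C4 R, dense (range D) ->
     [/\ compact_metrizable_convex (S_prime D),
         ~ choquet_simplex (S_prime D)
       & affinely_homeomorphic (S_prime D) (P_C4 R)]) /\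
  [/\ row 0 (C4_dist_matrix R) = r0 R, row 1 (C4_dist_matrix R) = r1 R,
      row 2 (C4_dist_matrix R) = r2 R & row 3 (C4_dist_matrix R) = r3 R] /\
  nondegenerate_parallelogram (P_C4 R) (b_C4 R) /\
  [/\ represents (P_C4 R) (mu02 R) (b_C4 R),
      represents (P_C4 R) (mu13 R) (b_C4 R),
      b_C4 R = row_integral (mu02 R) (P_C4 R),
      b_C4 R = row_integral (mu13 R) (P_C4 R)
    & ~ (mu02 R ≡μ mu13 R)].
Proof.
split=> [D dD|].
  have Ds := dense_C4_surjective dD; split.
  - exact: S_prime_C4_compact_metrizable_convex.
  - exact: S_prime_C4_not_choquet.
  - exact: S_prime_C4_affinely_homeomorphic.
have hV : hausdorff_space 'rV[R]_4 by exact: norm_hausdorff.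
have [b02 b13] := @b_C4E R.
have ext i := @extreme_P_C4 R i.
have := (ext 0, ext 1, ext 2, ext 3).
(* The rewriting also reaches the goal and makes the four row equalities reflexive. *)
rewrite !row_C4_dist_matrix /= => -[[[e0 e1] e2] e3].
split; first by [].
split; first exact: P_C4_nondegenerate.
split.
- by rewrite b02; exact: represents_half_dirac2 closed_P_C4 e0 e2.
- by rewrite b13; exact: represents_half_dirac2 closed_P_C4 e1 e3.
- by rewrite b02 row_integral_half_dirac2//;
    [exact: closed_P_C4|exact: e0.1|exact: e2.1].
- by rewrite b13 row_integral_half_dirac2//;
    [exact: closed_P_C4|exact: e1.1|exact: e3.1].
- by apply: half_dirac2_neq => //; [exact: r0_neq_r1|exact: r0_neq_r3].
Qed.
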